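(* Let $Y$ be a fixed real symmetric $n\times n$ matrix, $x\in\{0,1\}^n$ with exactly $k$ ones, $1\le k'\le n$, $\beta\ge0$, and $\ell>0$ with $1\le2\ell\le\min\{k,k'\}$, and suppose that $\mu_\beta$ has a free energy well of depth $D_{\beta,\ell}>0$ at correlation $\ell$ (with $A,B$ nonempty, so that $D_{\beta,\ell}$ is finite). Let $X_0,X_1,X_2,\dots$ be any Markov chain on the vertices of $\mathcal G$ (with transitions only along edges of $\mathcal G$, including self-loops) with stationary distribution $\mu_\beta$, initialized from $X_0\sim\mu_\beta(\cdot\,|\,A)$, and let $\tau_\beta:=\inf\{t\in\mathbb N:X_t\notin A\}$. Then for any integer $t\ge1$, $$\Pr\{\tau_\beta\le t\}\le t\exp(-D_{\beta,\ell}).$$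
   Context: $S_{k'}=\{v\in\{0,1\}^n:\|v\|_0=k'\}$, $H(v)=-v^\top Yv$, and $\mu_\beta$ is the probability measure on $S_{k'}$ with $\mu_\beta(v)\propto e^{-\beta H(v)}$. $A=\{v\in S_{k'}:0\le\langle v,x\rangle<\ell\}$, $B=\{v\in S_{k'}:\ell\le\langle v,x\rangle\le2\ell\}$; the depth of the free energy well at correlation $\ell$ is $D_{\beta,\ell}:=\log\mu_\beta(A)-\log\mu_\beta(B)$ (there is no free energy well if $D_{\beta,\ell}\le0$). $\mathcal G$ is the undirected graph with vertex set $S_{k'}$ in which two vertices are adjacent iff their Hamming distance is exactly $2$, with in addition a self-loop at every vertex. The Markov chain is time-homogeneous and is not assumed reversible. *)

(* Defs.v *)
From HB Require Import structures.
From mathcomp Require Import all_boot all_order all_algebra.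
From mathcomp Require Import all_classical all_reals all_analysis.

Set Implicit Arguments.
Unset Strict Implicit.
Unset Printing Implicit Defensive.

Import Order.TTheory GRing.Theory Num.Theory.
Import numFieldNormedType.Exports.

Local Open Scope classical_set_scope.
Local Open Scope ring_scope.

(* A vector of {0,1}^n is a column of booleans, so that {0,1}^n is a finType;
   [rvec] views it in R^n. *)
Notation cube n := 'cV[bool]_n.

Definition l0norm n (v : cube n) : nat := #|[set i | v i 0]%SET|.

Definition hamming n (u v : cube n) : nat := #|[set i | u i 0 != v i 0]%SET|.

Notation slice n k := {v : cube n | l0norm v == k}.

Definition rvec (R : realType) n (v : cube n) : 'cV[R]_n :=
  map_mx (fun b : bool => b%:R) v.

Definition inner (R : realType) n (u v : cube n) : R :=
  ((rvec R u)^T *m rvec R v) 0 0.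

Definition hamiltonian (R : realType) n (Y : 'M[R]_n) (v : cube n) : R :=
  - ((rvec R v)^T *m Y *m rvec R v) 0 0.

Section Gibbs.
Variables (R : realType) (n k : nat) (Y : 'M[R]_n) (beta : R).

Definition gibbs_weight (v : slice n k) : R :=
  expR (- beta * hamiltonian Y (val v)).

(* The point masses of mu_beta. *)
Definition gibbs (v : slice n k) : R :=
  gibbs_weight v / \sum_(u : slice n k) gibbs_weight u.

Definition mu (E : {set slice n k}) : R := \sum_(v in E) gibbs v.

Definition mu_cond (E F : {set slice n k}) : R := mu (E :&: F)%SET / mu F.

Variables (x : cube n) (ell : R).

Definition well : {set slice n k} :=
  [set v : slice n k | 0 <= inner R (val v) x < ell]%SET.

Definition barrier : {set slice n k} :=
  [set v : slice n k | ell <= inner R (val v) x <= 2 * ell]%SET.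

Definition well_depth : R := ln (mu well) - ln (mu barrier).

End Gibbs.

(* The edges of the graph G, self-loops included. *)
Definition edge n k (u v : slice n k) : bool :=
  (hamming (val u) (val v) == 2%N) || (u == v).

Section MarkovChain.
Context d (T : measurableType d) (R : realType) (P : probability T R).

Definition cond_prob (E F : set T) : R := fine (P (E `&` F)) / fine (P F).

Variable S : finType.

Definition stochastic (K : S -> S -> R) : Prop :=
  (forall u v, 0 <= K u v) /\ (forall u, \sum_v K u v = 1).

Definition stationary (K : S -> S -> R) (m : S -> R) : Prop :=
  forall v, \sum_u m u * K u v = m v.

Definition history (X : nat -> T -> S) (s : nat -> S) (t : nat) : set T :=
  [set w | forall i, (i <= t)%N -> X i w = s i].

(* Every X t is a random variable for the discrete sigma-algebra on S, and X is
   a time-homogeneous Markov chain with transition matrix K. *)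
Definition markov_chain (K : S -> S -> R) (X : nat -> T -> S) : Prop :=
  [/\ forall t (E : set S), measurable (X t @^-1` E),
      stochastic K
    & forall t (s : nat -> S), P (history X s t) != 0%E ->
        cond_prob [set w | X t.+1 w = s t.+1] (history X s t)
        = K (s t) (s t.+1)].

(* The infimum over an empty set of times is +oo. *)
Definition exit_time (X : nat -> T -> S) (A : {set S}) (w : T) : \bar R :=
  ereal_inf [set (t%:R : R)%:E | t in [set t : nat | X t w \notin A]].

End MarkovChain.

(* Main.v *)
(* By stationarity, the law of X_i stays below mu / mu(A) pointwise, because it
   does so at time 0. A chain leaving A moves along an edge, which changes the
   overlap with x by at most 1, hence it lands in B. So each step exits A with
   probability at most P(X_i in B) <= mu(B) / mu(A) = exp(- D), and a union
   bound over t steps concludes. *)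

Require Import Defs.
From HB Require Import structures.
From mathcomp Require Import all_boot all_order all_algebra.
From mathcomp Require Import all_classical all_reals all_analysis.
From mathcomp Require Import zify lra.

Set Implicit Arguments.
Unset Strict Implicit.
Unset Printing Implicit Defensive.

Import Order.TTheory GRing.Theory Num.Theory.
Import numFieldNormedType.Exports.

Local Open Scope classical_set_scope.
Local Open Scope ring_scope.

(** * Real-valued probabilities of events *)

Lemma fine_prob_le d (T : measurableType d) (R : realType)
    (P : probability T R) (E F : set T) :
  measurable E -> measurable F -> E `<=` F -> fine (P E) <= fine (P F).
Proof.
move=> mE mF EF; apply: fine_le; rewrite ?fin_num_measure//.
by apply: le_measure; rewrite ?inE.
Qed.

Lemma fine_probU_le d (T : measurableType d) (R : realType)
    (P : probability T R) (E F : set T) :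
  measurable E -> measurable F ->
  fine (P (E `|` F)) <= fine (P E) + fine (P F).
Proof.
move=> mE mF; rewrite -fineD ?fin_num_measure//.
apply: fine_le; rewrite ?fin_numD ?fin_num_measure//; first exact: measurableU.
exact: measureU2.
Qed.

Lemma fine_prob_fibers d (T : measurableType d) (R : realType)
    (P : probability T R) (I : finType) (f : T -> I) (D : {pred I})
    (E : set T) :
  measurable E -> (forall i, measurable (f @^-1` [set i])) ->
  fine (P (E `&` [set w | f w \in D])) =
  \sum_(i in D) fine (P (E `&` f @^-1` [set i])).
Proof.
move=> mE mf.
have -> : E `&` [set w | f w \in D] =
    \bigcup_(i in [set` D]) (E `&` f @^-1` [set i]).
  apply/seteqP; split=> w /=; first by case=> Ew Dw; exists (f w).
  by case=> i Di [Ew /= fw]; rewrite fw.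
have mEf i : measurable (E `&` f @^-1` [set i]) by exact: measurableI.
rewrite sum_fine => [|i _]; last by rewrite fin_num_measure.
rewrite measure_fin_bigcup//; last exact: trivIset_preimage1_in.
rewrite (fsbigE (enum D)) ?enum_uniq//.
- congr fine; rewrite -big_enum big_seq_cond [RHS]big_seq; apply: eq_bigl => i.
  by rewrite mem_enum mem_setE andbb.
- by move=> i /=; rewrite mem_enum.
- by move=> i /= Di; rewrite mem_enum Di.
Qed.

(** * Finite Markov chains: one-step laws and exit from a set *)

Section Chain.
Context d (T : measurableType d) (R : realType) (P : probability T R).
Context (S : finType) (K : S -> S -> R) (X : nat -> T -> S).
Context (X_markov : markov_chain P K X).

Let mX t (E : set S) : measurable (X t @^-1` E).
Proof. by case: X_markov. Qed.

Lemma measurable_history s t : measurable (history X s t).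
Proof.
have -> : history X s t = \bigcap_(i < t.+1) X i @^-1` [set s i].
  by apply/seteqP; split=> w h i; apply: h.
by apply: bigcap_measurable => [|i _]; [exists 0%N | exact: mX].
Qed.

(** The division-free Markov property. It also covers null histories, where conditioning says
    nothing but both sides vanish. *)
Lemma markov_history s t :
  fine (P ([set w | X t.+1 w = s t.+1] `&` history X s t)) =
  fine (P (history X s t)) * K (s t) (s t.+1).
Proof.
have mh := measurable_history s t.
have mXh : measurable ([set w | X t.+1 w = s t.+1] `&` history X s t).
  by apply: measurableI => //; exact: (mX t.+1 [set s t.+1]).
have [P0|Pn0] := eqVneq (P (history X s t)) 0%E.
  rewrite P0 mul0r; apply/eqP; rewrite eq_le fine_ge0// andbT.
  by rewrite -[leRHS]/(fine 0%E) -P0 fine_prob_le.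
have [_ _ /(_ t s Pn0) <-] := X_markov.
rewrite /cond_prob mulrC divfK//.
by rewrite fine_eq0 ?fin_num_measure.
Qed.

(** The Markov property conditions on a whole trajectory. Splitting over the finitely many
    trajectories up to time t reduces it to [X t] alone: those ending at u all carry the factor
    [K u v], the others contribute 0. *)
Lemma markov_step t u v :
  fine (P (X t @^-1` [set u] `&` X t.+1 @^-1` [set v])) =
  fine (P (X t @^-1` [set u])) * K u v.
Proof.
pose past w := [ffun i : 'I_t.+1 => X i w].
(* [history] takes an infinite sequence, so the finite past is continued by v; in particular
   [path g t.+1] is v. *)
pose path (g : {ffun 'I_t.+1 -> S}) i := if (i <= t)%N then g (inord i) else v.
have pathE g : past @^-1` [set g] = history X (path g) t.
  apply/seteqP; split=> w /= h.
    by move=> i it; rewrite /path it -h ffunE inordK.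
  by apply/ffunP => i; rewrite ffunE h -1?ltnS// /path -ltnS ltn_ord inord_val.
have mpast g : measurable (past @^-1` [set g]).
  by rewrite pathE; exact: measurable_history.
have predTE (E : set T) : E = E `&` [set w | past w \in predT].
  by apply/seteqP; split=> w //= -[].
rewrite [X in fine (P X)]predTE [in RHS](predTE (X t @^-1` _)).
rewrite !fine_prob_fibers//; last exact: measurableI.
rewrite mulr_suml; apply: eq_bigr => g _; rewrite pathE.
have [gu|gu] := eqVneq (path g t) u.
  have -> : X t @^-1` [set u] `&` history X (path g) t = history X (path g) t.
    by apply/setIidr => w /(_ t (leqnn t)); rewrite gu.
  have -> : X t @^-1` [set u] `&` X t.+1 @^-1` [set v] `&`
        history X (path g) t =
      [set w | X t.+1 w = path g t.+1] `&` history X (path g) t.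
    rewrite /path ltnn; apply/seteqP; split=> w /= [] => [[]//|].
    by move=> -> h; split=> //; split=> //; rewrite h.
  by rewrite markov_history gu /path ltnn.
have h0 : X t @^-1` [set u] `&` history X (path g) t = set0.
  apply/seteqP; split=> w //= [] Xu /(_ t (leqnn t)) Xg.
  by rewrite -Xg [_ == _](introT eqP Xu) in gu.
by rewrite setIAC h0 set0I measure0 mul0r.
Qed.

Lemma law_next t v :
  fine (P (X t.+1 @^-1` [set v])) = \sum_u fine (P (X t @^-1` [set u])) * K u v.
Proof.
have -> : X t.+1 @^-1` [set v] =
    X t.+1 @^-1` [set v] `&` [set w | X t w \in predT].
  by apply/seteqP; split=> w //= -[].
rewrite fine_prob_fibers//; apply: eq_bigr => u _.
by rewrite setIC markov_step.
Qed.

(** One step of the chain is monotone, since K is nonnegative, and fixes [c * m], so domination at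
    time 0 propagates by induction. *)
Lemma law_le_stationary (m : S -> R) c :
  stationary K m ->
  (forall v, fine (P (X 0 @^-1` [set v])) <= c * m v) ->
  forall t v, fine (P (X t @^-1` [set v])) <= c * m v.
Proof.
move=> mst h0; elim=> // t IH v; have [_ [K0 _] _] := X_markov.
rewrite law_next -mst mulr_sumr; apply: ler_sum => u _.
by rewrite mulrA ler_wpM2r.
Qed.

Lemma exit_prob_le (m : S -> R) c (A B : {set S}) :
  stationary K m ->
  (forall v, fine (P (X 0 @^-1` [set v])) <= c * m v) ->
  (forall v, v \notin A -> fine (P (X 0 @^-1` [set v])) = 0) ->
  (forall u v, u \in A -> v \notin A -> v \notin B -> K u v = 0) ->
  forall t,
  fine (P (\bigcup_(i < t.+1) [set w | X i w \notin A])) <=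
  t%:R * (c * \sum_(v in B) m v).
Proof.
move=> mst h0 hA hAB; elim=> [|t IH].
  (* The union covers t+1 times, but the chain starts in A, so time 0 costs nothing and the factor
     is t. *)
  rewrite mul0r bigcup_mkord big_ord1.
  have -> : [set w | X 0 w \notin A] =
      setT `&` [set w | X 0 w \in predC (mem A)].
    by rewrite setTI.
  rewrite fine_prob_fibers// big1// => v vA.
  by rewrite setTI hA.
(* An exit by time t+1 has either occurred by time t or lies in [F], the departure from A at this
   very step. *)
pose F := X t @^-1` [set` A] `&` [set w | X t.+1 w \notin A].
have mbad i : measurable [set w | X i w \notin A].
  exact: (mX i [set v | v \notin A]).
have mF : measurable F by apply: measurableI => //; exact: mX.
have mU s : measurable (\bigcup_(i < s) [set w | X i w \notin A]).
  exact: bigcup_measurable.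
apply: (@le_trans _ _
  (fine (P (\bigcup_(i < t.+1) [set w | X i w \notin A])) + fine (P F))).
  apply: le_trans (fine_probU_le _ _ mF) => //.
  apply: fine_prob_le => //; first exact: measurableU.
  move=> w [i /= it iA].
  have [Xt|Xt] := boolP (X t w \in A); last by left; exists t => /=.
  move: it; rewrite ltnS leq_eqVlt => /orP[/eqP ei|it].
    by right; rewrite ei in iA; split.
  by left; exists i.
rewrite -natr1 mulrDl mul1r lerD//.
have -> : F = X t @^-1` [set` A] `&` [set w | X t.+1 w \in predC (mem A)] by [].
rewrite fine_prob_fibers//.
(* Landing points outside both A and B have probability 0: no transition from A reaches them. *)
rewrite mulr_sumr (bigID (mem B))/= [X in _ + X]big1 ?addr0; last first.
  move=> v /andP[vA vB].
  rewrite setIC [X in _ `&` X](_ : _ = [set w | X t w \in mem A])//.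
  rewrite fine_prob_fibers// big1// => u uA.
  by rewrite setIC markov_step hAB ?mulr0.
rewrite big_mkcondl/=; apply: ler_sum => v _.
apply: le_trans (law_le_stationary mst h0 t.+1 v).
case: ifP => _; last exact: fine_ge0.
by apply: fine_prob_le => //; exact: measurableI.
Qed.

Lemma exit_time_leE (A : {set S}) t :
  [set w | (exit_time R X A w <= (t%:R : R)%:E)%E] =
  \bigcup_(i < t.+1) [set w | X i w \notin A].
Proof.
apply/seteqP; split=> w /=.
  move=> h.
  (* A strict bound on the infimum yields an actual exit time below it; being an integer below t+1,
     it is at most t. *)
  have : (exit_time R X A w < (t.+1%:R : R)%:E)%E.
    by apply: le_lt_trans h _; rewrite lte_fin ltr_nat.
  by move=> /ereal_inf_lt[_ [i iA <-]]; rewrite lte_fin ltr_nat; exists i.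
case=> i it iA; apply: (@le_trans _ _ (i%:R : R)%:E).
  by apply: ereal_inf_lbound; exists i.
by rewrite lee_fin ler_nat.
Qed.

End Chain.

(** * Overlap with x along edges of the slice *)

Lemma innerE (R : realType) n (u v : cube n) :
  inner R u v = #|[set i | u i 0 && v i 0]%SET|%:R.
Proof.
rewrite /inner mxE -sum1_card natr_sum [RHS]big_mkcond/=; apply: eq_bigr => i _.
by rewrite !mxE inE -natrM mulnb; case: (_ && _).
Qed.

(** The supports U and V have equal size, so at Hamming distance 2 each of U minus V and V minus U
    is a single point, and only the latter can add to the overlap. *)
Lemma inner_edge_le (R : realType) n k (x : cube n) (u v : slice n k) :
  edge u v -> inner R (val v) x <= inner R (val u) x + 1.
Proof.
case/orP=> [|/eqP->]; last by rewrite lerDl.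
case: u v => [u /= /eqP uk] [v /= /eqP vk] /eqP; rewrite !innerE natr1 ler_nat.
rewrite /hamming /l0norm in uk vk *.
set U := [set i | u i 0]%SET in uk; set V := [set i | v i 0]%SET in vk.
pose Q := [set i | x i 0]%SET.
have -> : [set i | u i 0 != v i 0]%SET = ((U :\: V) :|: (V :\: U))%SET.
  by apply/setP=> i; rewrite !inE; case: (u i 0); case: (v i 0).
have -> : [set i | u i 0 && x i 0]%SET = (U :&: Q)%SET.
  by apply/setP=> i; rewrite !inE.
have -> : [set i | v i 0 && x i 0]%SET = (V :&: Q)%SET.
  by apply/setP=> i; rewrite !inE.
rewrite cardsU (_ : (_ :&: _)%SET = finset.set0) ?cards0; last first.
  by apply/setP=> i; rewrite !inE; case: (u i 0); case: (v i 0).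
have sub : (V :&: Q \subset (U :&: Q) :|: (V :\: U))%SET.
  apply/fintype.subsetP=> i; rewrite !inE.
  by case: (u i 0); case: (v i 0); case: (x i 0).
have := leq_trans (subset_leq_card sub) (leq_card_setU _ _).1.
have := cardsID V U; have := cardsID U V; rewrite finset.setIC uk vk; lia.
Qed.

(* The inner product is an integer, and so jumps from some a < ell to at most
   a + 1: this is at most 2 * ell because 2 * ell >= 1 settles a = 0. *)
Lemma edge_well_barrier (R : realType) n k (x : cube n) (ell : R)
    (u v : slice n k) :
  1 <= 2 * ell -> edge u v ->
  u \in well k x ell -> v \notin well k x ell -> v \in barrier k x ell.
Proof.
move=> ell1 /(inner_edge_le R x); rewrite !inE !innerE !ler0n/= -leNgt.
case: #|[set i | (val u) i 0 && x i 0]%SET| => [|a] uv ul lv; rewrite lv/=.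
  lra.
move: uv ul; rewrite -natr1; have := ler0n R a; lra.
Qed.

(** * Positivity of the Gibbs measure and the final bound *)

Lemma gibbs_gt0 (R : realType) n k (Y : 'M[R]_n) (beta : R) (v : slice n k) :
  0 < gibbs Y beta v.
Proof.
rewrite divr_gt0 ?expR_gt0// (bigD1 v)//= ltr_pwDl ?expR_gt0//.
by apply: sumr_ge0 => u _; rewrite expR_ge0.
Qed.

(** Positivity lets [expR] undo the logarithms in the depth. *)
Lemma mu_gt0 (R : realType) n k (Y : 'M[R]_n) (beta : R) (E : {set slice n k}) :
  E != finset.set0 -> 0 < mu Y beta E.
Proof.
case/set0Pn=> v vE; rewrite /mu (bigD1 v)//= ltr_pwDl ?gibbs_gt0//.
by apply: sumr_ge0 => u _; rewrite ltW ?gibbs_gt0.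
Qed.

Lemma mu_cond_set1 (R : realType) n k (Y : 'M[R]_n) (beta : R)
    (v : slice n k) (E : {set slice n k}) :
  mu_cond Y beta (finset.set1 v) E =
  (if v \in E then gibbs Y beta v else 0) / mu Y beta E.
Proof.
rewrite /mu_cond; congr (_ / _); rewrite {1}/mu; case: ifPn => vE.
  by rewrite (finset.setIidPl _) ?finset.sub1set // big_set1.
by rewrite disjoint_setI0 ?disjoints1// big_set0.
Qed.

Theorem proposition2p2 (R : realType) (n k k' : nat) (Y : 'M[R]_n)
    (x : cube n) (beta ell : R)
    (Ysym : Y^T = Y) (xk : l0norm x = k) (k'_bounds : (1 <= k' <= n)%N)
    (beta_ge0 : 0 <= beta) (ell_gt0 : 0 < ell)
    (ell_bounds : 1 <= 2 * ell <= Num.min (k%:R : R) (k'%:R : R))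
    (A_neq0 : well k' x ell != finset.set0)
    (B_neq0 : barrier k' x ell != finset.set0)
    (depth_gt0 : 0 < well_depth k' Y beta x ell)
    (d : measure_display) (T : measurableType d) (P : probability T R)
    (K : slice n k' -> slice n k' -> R) (X : nat -> T -> slice n k')
    (X_markov : markov_chain P K X)
    (K_edges : forall u v, 0 < K u v -> edge u v)
    (K_stationary : stationary K (gibbs Y beta))
    (X_init : forall v, P [set w | X 0%N w = v] =
       (mu_cond Y beta (finset.set1 v) (well k' x ell))%:E)
    (t : nat) (t_ge1 : (1 <= t)%N) :
  (P [set w | (exit_time R X (well k' x ell) w <= (t%:R : R)%:E)%E] <=
     (t%:R * expR (- well_depth k' Y beta x ell))%:E)%E.
Proof.
have muA := mu_gt0 Y beta A_neq0; have muB := mu_gt0 Y beta B_neq0.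
have [mX [K_ge0 _] _] := X_markov.
rewrite exit_time_leE -[leLHS]fineK ?fin_num_measure//; last first.
  by apply: bigcup_measurable => // i _; exact: (mX i [set v | v \notin _]).
rewrite lee_fin /well_depth opprB expRD expRN !lnK ?posrE// mulrC.
(* The initial law is the Gibbs mass cut down to A and divided by its mass there, hence dominated
   with c the inverse of [mu] of the well. *)
have init v : fine (P (X 0 @^-1` [set v])) =
    (if v \in well k' x ell then gibbs Y beta v else 0) /
      mu Y beta (well k' x ell).
  by rewrite -mu_cond_set1 -[RHS]/(fine _%:E) -X_init.
rewrite mulrC [mu _ _ (barrier _ _ _) / _]mulrC.
apply: (exit_prob_le X_markov K_stationary).
- move=> v; rewrite init mulrC; apply: ler_wpM2l; first by rewrite invr_ge0 ltW.
  by case: ifP => // _; exact/ltW/gibbs_gt0.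
- by move=> v /negPf vA; rewrite init vA mul0r.
(* Contrapositive: a nonzero transition is positive, so it follows an edge, and an edge leaving A
   lands in B. *)
move=> u v uA vA; apply: contraNeq => Kuv.
have {}Kuv : edge u v by apply: K_edges; rewrite lt0r Kuv K_ge0.
by case/andP: ell_bounds => ell1 _; exact: edge_well_barrier uA vA.
Qed.
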